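(* Let $X$ and $Y$ be topological spaces, each of which is both pseudocompact and functionally countable. Then $X\times Y$ is pseudocompact, and hence functionally countable.
   Context: All spaces are assumed to be Hausdorff. A space $X$ is pseudocompact if it is Tychonoff and every continuous real-valued function defined on $X$ is bounded. A space $X$ is functionally countable if every continuous function $f\colon X\to\mathbb{R}$ has countable image. $X\times Y$ carries the product topology. *)

(* Defs.v *)
From HB Require Import structures.
From mathcomp Require Import all_boot all_order all_algebra.
From mathcomp Require Import all_classical all_reals all_analysis.

Set Implicit Arguments.
Unset Strict Implicit.
Unset Printing Implicit Defensive.

Import numFieldNormedType.Exports.

Local Open Scope classical_set_scope.
Local Open Scope ring_scope.

(* [completely_regular_space] is phrased with uniformities; by
   [uniform_separatorP] it says that a point and a closed set not containing
   it are separated by a continuous function into [0, 1]. *)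
Definition tychonoff_space (X : topologicalType) : Prop :=
  hausdorff_space X /\ completely_regular_space X.

Definition pseudocompact (R : realType) (X : topologicalType) : Prop :=
  tychonoff_space X /\ forall f : X -> R, continuous f -> bounded_fun f.

Definition functionally_countable (R : realType) (X : topologicalType) : Prop :=
  forall f : X -> R, continuous f -> countable (range f).

(* Main.v *)
Require Import Defs.
From HB Require Import structures.
From mathcomp Require Import all_boot all_order all_algebra.
From mathcomp Require Import all_classical all_reals all_analysis.
From mathcomp Require Import lra.

(** The proof rests on one dichotomy, [no_splitting]: in a pseudocompact
    functionally countable space there is no Cantor tree of clopen cuts.
    Otherwise pseudocompactness would give a point on each branch of the tree,
    while countably many clopen sets can be assembled, through a ternary
    expansion, into a single continuous real function which tells all the
    branches apart and so has uncountable range.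

    Two consequences of it are used. Isolated points are dense
    ([isolated_dense]): an open set without isolated points could be cut in two
    for ever, because functional countability makes the space zero-dimensional.
    Every sequence of isolated points has a subsequence converging in the space
    ([isolated_seq_subconverges]): an infinite set of indices without such a
    subsequence could also be cut in two for ever, around a cluster point.
    In the language of compactifications, the Stone-Cech compactification is
    scattered, hence sequentially compact with dense isolated points, and the
    limits of sequences of isolated points cannot leave the space.

    In [X * Y], pairs of isolated points are therefore dense, and every sequence
    of them clusters: a subsequence whose first coordinates converge is chosen,
    then a cluster point of the second coordinates along it. A continuous
    function exceeding [n] at the [n]-th pair would be discontinuous at a
    cluster point, so the product is pseudocompact.

    For functional countability, let [f] be continuous on [X * Y]. The same
    clustering shows that the slices [f (x, _)] depend continuously on [x] for
    uniform convergence ([slices_equicontinuous]) and are totally bounded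
    ([slices_totally_bounded]). So countably many points of [X] suffice to
    determine [f (_, y)] from its values there; since the joint values of
    countably many continuous functions on [Y] form a countable set
    ([joint_range_countable]), there are only countably many slices [f (_, y)],
    each of countable range. *)

Set Implicit Arguments.
Unset Strict Implicit.
Unset Printing Implicit Defensive.

Import Order.TTheory GRing.Theory Num.Theory.
Import numFieldNormedType.Exports.

Local Open Scope classical_set_scope.
Local Open Scope ring_scope.

(** * Ternary codes and countable ranges *)

Section CantorCode.
Context {R : realType}.
Implicit Types b c : nat -> bool.

Definition ternary_sum b (n : nat) : R :=
  \sum_(i < n) if b i then 3^-1 ^+ i else 0.

(** Binary sequences are embedded in the reals as points of a Cantor set. Base 3
    with digits 0 and 1 keeps the embedding injective: the whole tail after a
    position weighs at most half of a digit 1 at that position. *)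
Definition ternary b : R := sup (range (ternary_sum b)).

Lemma ternary_sumS b n :
  ternary_sum b n.+1 = ternary_sum b n + if b n then 3^-1 ^+ n else 0.
Proof. exact: big_ord_recr. Qed.

Lemma ternary_sum_mono b m n : (m <= n)%N -> ternary_sum b m <= ternary_sum b n.
Proof.
elim: n => [|n IH]; first by rewrite leqn0 => /eqP ->.
rewrite leq_eqVlt => /predU1P[->//|/IH{}IH]; apply: (le_trans IH).
by rewrite ternary_sumS lerDl; case: ifP.
Qed.

Lemma ternary_sum_tail b m n : (m <= n)%N ->
  ternary_sum b n + 3 / 2 * 3^-1 ^+ n <= ternary_sum b m + 3 / 2 * 3^-1 ^+ m.
Proof.
elim: n => [|n IH]; first by rewrite leqn0 => /eqP ->.
rewrite leq_eqVlt => /predU1P[->//|/IH{}IH]; apply: le_trans IH.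
rewrite ternary_sumS exprS.
have : 0 <= (3^-1 : R) ^+ n by rewrite exprn_ge0// invr_ge0.
by case: ifP => _; lra.
Qed.

Lemma ternary_bounds b n :
  ternary_sum b n <= ternary b <= ternary_sum b n + 3 / 2 * 3^-1 ^+ n.
Proof.
have ub : ubound (range (ternary_sum b)) (ternary_sum b n + 3 / 2 * 3^-1 ^+ n).
  move=> _ [m _ <-].
  have [mn|/ltnW nm] := leqP m n.
    apply: (le_trans (ternary_sum_mono b mn)).
    by rewrite lerDl mulr_ge0// exprn_ge0// invr_ge0.
  apply: le_trans (ternary_sum_tail b nm).
  by rewrite lerDl mulr_ge0// exprn_ge0// invr_ge0.
apply/andP; split.
  by apply: ub_le_sup; [exists (ternary_sum b n + 3 / 2 * 3^-1 ^+ n)|exists n].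
by apply: ge_sup => //; exists (ternary_sum b 0), 0%N.
Qed.

Lemma eq_ternary_sum b c n : (forall i, (i < n)%N -> b i = c i) ->
  ternary_sum b n = ternary_sum c n.
Proof. by move=> bc; apply: eq_bigr => i _; rewrite bc. Qed.

Lemma ternary_close b c n : (forall i, (i < n)%N -> b i = c i) ->
  `|ternary b - ternary c| <= 3 / 2 * 3^-1 ^+ n.
Proof.
move=> /eq_ternary_sum bc; rewrite ler_norml.
have := ternary_bounds b n; have := ternary_bounds c n; rewrite bc.
by move=> /andP[? ?] /andP[? ?]; lra.
Qed.

Lemma ternary_inj : injective ternary.
Proof.
move=> b c bc; apply: contrapT => nbc.
have ex : exists i, b i != c i.
  have /existsNP[i /eqP bci] : ~ (forall i, b i = c i).
    by move=> e; apply: nbc; exact/funext.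
  by exists i.
case: (ex_minnP ex) => k kP kmin.
have agree i : (i < k)%N -> b i = c i.
  move=> ik; apply/eqP; apply: contraTT ik => /kmin.
  by rewrite -leqNgt.
(* At the first difference [k], the digit [3^-k] exceeds the largest possible
   tail, [3/2 * 3^-(k+1)]. *)
have := ternary_bounds b k.+1; have := ternary_bounds c k.+1.
rewrite !ternary_sumS (eq_ternary_sum agree) bc exprS.
have : 0 < (3^-1 : R) ^+ k by rewrite exprn_gt0// invr_gt0.
by move: kP; case: (b k); case: (c k) => // _ h /andP[? ?] /andP[? ?]; lra.
Qed.

End CantorCode.

Lemma countable_range_factor (T U V : Type) (c : T -> U) (G : T -> V) :
  (forall x y, c x = c y -> G x = G y) ->
  countable (range c) -> countable (range G).
Proof.
move=> cG cc.
have [->|/set0P[_ [x0 _ _]]] := eqVneq (range G) set0; first exact: countable0.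
have /choice[h hP] : forall u, exists x, range c u -> c x = u.
  move=> u; have [[x _ xu]|nu] := pselect (range c u); first by exists x.
  by exists x0.
suff -> : range G = (G \o h) @` range c.
  exact: sub_countable (card_image_le _ _) cc.
apply/seteqP; split => [_ [x _ <-]|_ [u _ <-]].
  by exists (c x); [exists x|apply: cG; apply: hP; exists x].
by exists (h u).
Qed.

(** Cantor's diagonal argument, run against an injection [f] into [nat]: the
    [n]-th row is read off the sequence coded by [n], if there is one. *)
Lemma uncountable_bool_seq : ~ countable [set: nat -> bool].
Proof.
move=> /countable_injP[f finj].
pose g (n : nat) : nat -> bool :=
  fun k => `[< exists b : nat -> bool, f b = n /\ b k >].
pose d (k : nat) : bool := ~~ g k k.
have : g (f d) (f d) = d (f d).
  rewrite {1}/g; case dd : (d (f d)).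
    by apply/asboolP; exists d.
  apply/asboolP => -[b [fb bk]].
  have bd : b = d by apply: finj => //; rewrite inE.
  by move: bk; rewrite bd dd.
by rewrite /d; case: (g _ _).
Qed.

(** A nonempty open interval has positive Lebesgue measure, a countable set does
    not. *)
Lemma countable_avoid {R : realType} (A : set R) (a b : R) :
  countable A -> a < b -> exists r, [/\ a < r, r < b & ~ A r].
Proof.
move=> cA ab; apply: contrapT => no.
have sub : `]a, b[%classic `<=` A.
  move=> r /=; rewrite in_itv/= => /andP[ar rb]; apply: contrapT => nAr.
  by apply: no; exists r.
have c0 : countable (`]a, b[%classic : set R).
  exact: sub_countable (subset_card_le sub) cA.
have := countable_lebesgue_measure0 c0.
rewrite lebesgue_measure_itv/= lte_fin ab -EFinD => -[] /eqP.
by rewrite subr_eq0 gt_eqF.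
Qed.

(** * Clopen sets in pseudocompact and functionally countable spaces *)

Lemma clopen_near_mem {X : topologicalType} (C : set X) (x : X) :
  clopen C -> \forall y \near x, C y <-> C x.
Proof.
move=> [oC cC]; have [Cx|nCx] := pselect (C x).
  by apply: filterS (open_nbhs_nbhs (conj oC Cx)) => y Cy; split.
have : nbhs x (~` C) by apply: open_nbhs_nbhs; split => //; exact: closed_openC.
by apply: filterS => y nCy; split => // /nCy.
Qed.

Lemma clopen_near_prefix {X : topologicalType} (C : nat -> set X) (x : X) n :
  (forall i, clopen (C i)) ->
  \forall y \near x, forall i, (i < n)%N -> C i y <-> C i x.
Proof.
move=> cC; elim: n => [|n IH]; first by near=> y => i; rewrite ltn0.
apply: filterS2 IH (clopen_near_mem x (cC n)) => y IH Cn i.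
by rewrite ltnS leq_eqVlt => /predU1P[->//|]; exact: IH.
Unshelve. all: by end_near. Qed.

(** If no point lies in all the [C n], the least [n] with [x] outside [C n] is
    a locally constant function of [x]; it is unbounded because every [C n] is
    inhabited. *)
Lemma nested_clopen_meet {R : realType} {X : topologicalType}
    (C : nat -> set X) :
  pseudocompact R X -> (forall n, clopen (C n)) ->
  (forall n, C n.+1 `<=` C n) -> (forall n, C n !=set0) ->
  exists x, forall n, C n x.
Proof.
move=> [_ bX] cC dC neC; apply: contrapT => no.
have decr i n : (i <= n)%N -> C n `<=` C i.
  elim: n => [|n IH]; first by rewrite leqn0 => /eqP ->.
  by rewrite leq_eqVlt => /predU1P[->//|/IH{}IH]; apply: subset_trans IH.
have ex x : exists n, ~~ `[< C n x >].
  apply: contrapT => nex; apply: no; exists x => n; apply: contrapT => nC.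
  by apply: nex; exists n; apply/asboolPn.
pose m x := ex_minn (ex x).
have m_out x : ~ C (m x) x by rewrite /m; case: ex_minnP => n /asboolPn.
have m_in x i : (i < m x)%N -> C i x.
  rewrite /m; case: ex_minnP => n _ nmin; rewrite ltnNge => /negP ni.
  by apply: contrapT => nC; apply: ni; apply: nmin; apply/asboolPn.
have cf : continuous (fun x => (m x)%:R : R).
  move=> x; apply: cvg_near_cst.
  apply: filterS (clopen_near_prefix x (m x).+1 cC) => y yx.
  have le_yx : (m y <= m x)%N.
    rewrite leqNgt; apply/negP => /m_in /(yx _ (ltnSn _)); exact: m_out.
  have le_xy : (m x <= m y)%N.
    rewrite leqNgt; apply/negP => xy; apply: (m_out y).
    by apply/(yx _ (leqW xy)); exact: m_in.
  have yx_eq : m y = m x by apply: anti_leq; rewrite le_yx.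
  by rewrite yx_eq.
have [M [_ /(_ (M + 1))]] := bX _ cf.
rewrite ltrDl ltr01 => /(_ isT) bM.
pose k := Num.truncn (M + 1).
have [x Cx] := neC k.+1.
have : (k.+1 < m x)%N.
  by rewrite ltnNge; apply/negP => /decr/(_ _ Cx); exact: m_out.
have := bM x I; rewrite /= normr_nat => mx.
have := le_lt_trans mx (truncnS_gt (M + 1)); rewrite ltr_nat => mk km.
by have := ltn_trans km mk; rewrite ltnn.
Qed.

(** The ternary code of the trace is a continuous real function of the point,
    and it determines the trace. *)
Lemma clopen_seq_trace_countable {R : realType} {X : topologicalType}
    (C : nat -> set X) :
  functionally_countable R X -> (forall n, clopen (C n)) ->
  countable (range (fun x n => `[< C n x >])).
Proof.
move=> cX cC; pose h x : R := ternary (fun n => `[< C n x >]).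
apply: (@countable_range_factor _ _ _ h); first by move=> x y /ternary_inj.
apply: cX => x; apply/cvgrPdist_le => e e0.
have [n ne] : exists n, 3 / 2 * 3^-1 ^+ n <= e :> R.
  have : (fun n => geometric (3 / 2 : R) 3^-1 n) @ \oo --> 0.
    by apply: cvg_geometric; rewrite ger0_norm// invf_lt1// ltr1n.
  move=> /cvgrPdist_le /(_ _ e0) [n _ /(_ n (leqnn _))].
  rewrite /= sub0r normrN ger0_norm; first by exists n.
  by rewrite mulr_ge0.
apply: filterS (clopen_near_prefix x n cC) => y yx.
apply: le_trans ne; apply: ternary_close => i /yx yxi.
by apply/asboolP/asboolP => /yxi.
Qed.

Lemma clopen_trace_countable {R : realType} {X : topologicalType}
    {I : countType} (C : I -> set X) :
  functionally_countable R X -> (forall i, clopen (C i)) ->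
  countable (range (fun x i => `[< C i x >])).
Proof.
move=> cX cC; pose D n := if unpickle n is Some i then C i else set0.
have cD n : clopen (D n).
  by rewrite /D; case: unpickle => [i|]; [exact: cC|exact: clopen0].
apply: countable_range_factor (clopen_seq_trace_countable cX cD) => x y xy.
apply/funext => i; have := congr1 (@^~ (pickle i)) xy.
by rewrite /D /= pickleK.
Qed.

Lemma gap_clopen {R : realType} {X : topologicalType} (f : X -> R) (r : R) :
  continuous f -> ~ range f r -> clopen [set x | f x < r].
Proof.
move=> cf nr; split.
  apply: (@open_comp _ _ f [set t | t < r]) => [x _|]; first exact: cf.
  exact: open_lt.
suff -> : [set x | f x < r] = [set x | f x <= r].
  by apply: (@preimage_closed _ _ f [set t | t <= r]) => //; exact: closed_le.
apply/seteqP; split => x /=; first exact: ltW.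
by rewrite le_eqVlt => /predU1P[fx|//]; case: nr; exists x.
Qed.

(** A separating function takes countably many values, so it can be cut at a
    level between 0 and 1 that it misses. *)
Lemma clopen_base {R : realType} {X : topologicalType} (x : X) (U : set X) :
  completely_regular_space X -> functionally_countable R X ->
  nbhs x U -> exists C, [/\ clopen C, C x & C `<=` U].
Proof.
move=> crX cX; rewrite nbhsE => -[V [oV Vx] VU].
have /(@uniform_separatorP _ R)[f [cf _ f0 f1]] :
    uniform_separator [set x] (~` V).
  by apply: crX; [exact: open_closedC|exact].
have [r [r0 r1 nr]] := countable_avoid (cX f cf) (@ltr01 R).
exists [set y | f y < r]; split; first exact: gap_clopen.
  by rewrite /= (f0 (f x)) //; exists x.
move=> y /= fy; apply: VU; apply: contrapT => nVy.
have f1y : f y = 1 by apply: f1; exists y.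
by move: fy; rewrite f1y ltNge (ltW r1).
Qed.

Lemma clopen_base_completely_regular {R : realType} {X : topologicalType} :
  (forall (x : X) U, nbhs x U -> exists C, [/\ clopen C, C x & C `<=` U]) ->
  completely_regular_space X.
Proof.
move=> base x B cB nBx.
have [|C [cC Cx CB]] := base x (~` B).
  by apply: open_nbhs_nbhs; split => //; exact: closed_openC.
apply/(@uniform_separatorP _ R); exists (fun y => if `[< C y >] then 0 else 1).
split.
- move=> y; apply: cvg_near_cst; apply: filterS (clopen_near_mem y cC) => z zy.
  by congr (if _ then _ else _); apply/asboolP/asboolP => /zy.
- move=> _ [y _ <-]; rewrite /= in_itv /=.
  by case: ifP => _; rewrite ?lexx ?ler01.
- by move=> _ [_ -> <-] /=; rewrite asboolT.
- by move=> _ [y By <-] /=; rewrite asboolF// => /CB.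
Qed.

(** * Cantor trees of clopen cuts *)

Definition cut_side {X : Type} (c : set X -> set X) (b : bool) (A : set X) :=
  if b then c A else ~` c A.

(** The most recent cut is at the head of the sequence of bits. *)
Fixpoint cell {X : Type} (c : set X -> set X) (A0 : set X) (s : seq bool) :=
  if s is b :: s' then cell c A0 s' `&` cut_side c b (cell c A0 s') else A0.

Definition prefix_cell {X : Type} (c : set X -> set X) (A0 : set X)
    (b : nat -> bool) (n : nat) := cell c A0 (rev (mkseq b n)).

Lemma prefix_cellS {X : Type} (c : set X -> set X) (A0 : set X) b n :
  prefix_cell c A0 b n.+1 =
  prefix_cell c A0 b n `&` cut_side c (b n) (prefix_cell c A0 b n).
Proof. by rewrite /prefix_cell mkseqS rev_rcons. Qed.

(** Cutting for ever would yield a tree of clopen cuts in which, by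
    [nested_clopen_meet], each of the uncountably many branches contains a
    point. The trace of a point on the countably many cuts determines its
    branch, which contradicts [clopen_trace_countable]. *)
Lemma no_splitting {R : realType} {X : topologicalType} (P : set X -> Prop) :
  pseudocompact R X -> functionally_countable R X ->
  (forall A, P A -> A !=set0) ->
  (forall A, P A -> exists C, [/\ clopen C, P (A `&` C) & P (A `&` ~` C)]) ->
  forall A, ~ P A.
Proof.
move=> pX cX P0 Psplit A0 PA0.
have /choice[c cP] : forall A, exists C,
    clopen C /\ (P A -> P (A `&` C) /\ P (A `&` ~` C)).
  move=> A; have [/Psplit[C [cC P1 P2]]|nPA] := pselect (P A); first by exists C.
  by exists setT; split; [exact: clopenT|].
have cc A : clopen (c A) by have [] := cP A.
have Pcell b n : P (prefix_cell c A0 b n).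
  elim: n => [//|n IH]; rewrite prefix_cellS.
  by have [_ /(_ IH)[]] := cP (prefix_cell c A0 b n); case: (b n).
have cside b A : clopen (cut_side c b A).
  by rewrite /cut_side; case: b => //; exact: clopenC.
(* The cells need not be clopen; the cuts are, and their finite intersections
   along a branch contain the cells, hence are inhabited. *)
have branch b : exists x, forall n, cut_side c (b n) (prefix_cell c A0 b n) x.
  pose E n := [set x |
    forall i, (i < n)%N -> cut_side c (b i) (prefix_cell c A0 b i) x].
  have ES n : E n.+1 = E n `&` cut_side c (b n) (prefix_cell c A0 b n).
    apply/seteqP; split => [x Ex|x [Ex Sx] i].
      by split => [i /leqW|]; exact: Ex.
    by rewrite ltnS leq_eqVlt => /predU1P[->//|]; exact: Ex.
  have [n|n|n|x Ex] := nested_clopen_meet (C := E) pX.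
  - elim: n => [|n IH]; last by rewrite ES; exact: clopenI.
    by rewrite (_ : E 0%N = setT); [exact: clopenT|apply/seteqP].
  - by rewrite ES => x [].
  - have [x Ax] := P0 _ (Pcell b n); exists x.
    elim: n Ax => [//|n IH]; rewrite prefix_cellS => -[/IH Ex Sx].
    by rewrite ES.
  - by exists x => n; apply: (Ex n.+1).
have /choice[x xP] := branch.
(* Two branches that differ leave some common cell on opposite sides. *)
have trace_inj b b' :
    (forall s, c (cell c A0 s) (x b) <-> c (cell c A0 s) (x b')) -> b = b'.
  move=> bb'; apply/funext => n.
  elim/ltn_ind: n => n IH.
  have eq_prefix : prefix_cell c A0 b n = prefix_cell c A0 b' n.
    rewrite /prefix_cell; congr (cell _ _ (rev _)).
    apply/eq_in_map => i; rewrite mem_iota => /andP[_]; exact: IH.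
  have := xP b n; have := xP b' n; rewrite -eq_prefix.
  have := bb' (rev (mkseq b n)); rewrite -/(prefix_cell c A0 b n) /cut_side.
  by case: (b n); case: (b' n) => // e h1 h2; [case: h1|case: h2]; apply/e.
apply: uncountable_bool_seq.
have ct := clopen_trace_countable cX (fun s => cc (cell c A0 s)).
rewrite -(_ : range (fun b : nat -> bool => b) = setT); last first.
  by apply/seteqP; split => // b _; exists b.
apply: (countable_range_factor (c := fun b s => `[< c (cell c A0 s) (x b) >])).
  move=> b b' e; apply: trace_inj => s.
  have /= es := congr1 (@^~ s) e.
  by split => /asboolP h; apply/asboolP; [rewrite -es|rewrite es].
by apply: sub_countable ct; apply: subset_card_le => _ [b _ <-]; exists (x b).
Qed.

(** * Isolated points *)

(** In an open set without isolated points, every nonempty open subset contains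
    two points and is split by a clopen set. *)
Lemma isolated_dense {R : realType} {X : topologicalType} (U : set X) :
  pseudocompact R X -> functionally_countable R X ->
  open U -> U !=set0 -> exists2 x, U x & open [set x].
Proof.
move=> pX cX oU neU; apply: contrapT => no.
have [[hX crX] _] := pX.
pose P A := [/\ open A, A !=set0 & A `<=` U].
suff split_P A : P A -> exists C, [/\ clopen C, P (A `&` C) & P (A `&` ~` C)].
  by have := no_splitting pX cX _ split_P (A := U); apply; [move=> A []|split].
move=> [oA [x Ax] AU].
have [y Ay yx] : exists2 y, A y & y <> x.
  apply: contrapT => noy; apply: no; exists x; first exact: AU.
  suff -> : [set x] = A by [].
  apply/seteqP; split => [_ -> //|y Ay]; apply: contrapT => yx.
  by apply: noy; exists y.
have nbx : nbhs x (~` [set y]).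
  apply: open_nbhs_nbhs; split; last by move=> /esym.
  by apply: closed_openC; exact/accessible_closed_set1/hausdorff_accessible.
have [C [cC Cx Cy]] := clopen_base crX cX nbx.
have [oC _] := cC; have [oC' _] := clopenC C cC.
exists C; split => //.
  by split; [exact: openI|exists x|exact: subIset (or_introl AU)].
split; [exact: openI| |exact: subIset (or_introl AU)].
by exists y; split => // /Cy; apply.
Qed.

Lemma infinite_set_natP (A : set nat) :
  infinite_set A <-> forall k, exists2 n, (k <= n)%N & A n.
Proof.
split=> [iA k|cofinal /finite_seqP[s As]].
  have /infinite_setN0[n [An /negP]] := infinite_setD iA (finite_II k).
  by rewrite -leqNgt => kn; exists n.
have [n] := cofinal (\max_(i <- s) i).+1; rewrite As /= => + ns.
by rewrite ltnNge (@leq_bigmax_seq _ s xpredT id).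
Qed.

(** Without a cluster point, the tails of the sequence would be decreasing clopen
    sets: open because their points are isolated, closed because every point has
    a neighbourhood meeting them in a finite set. A point common to all tails is
    a cluster point after all. *)
Lemma isolated_seq_clusters {R : realType} {X : topologicalType}
    (x : nat -> X) (M : set nat) :
  pseudocompact R X -> (forall n, open [set x n]) -> infinite_set M ->
  exists p : X, forall U, nbhs p U -> infinite_set (M `&` x @^-1` U).
Proof.
move=> pX ox iM; apply: contrapT => no.
have hX : hausdorff_space X by case: pX => -[].
have sparse (p : X) : exists2 U, nbhs p U & finite_set (M `&` x @^-1` U).
  apply: contrapT => nU; apply: no; exists p => U pU fU.
  by apply: nU; exists U.
pose W k := x @` (M `&` [set n | (k <= n)%N]).
have oW k : open (W k).
  rewrite openE => _ [n [Mn kn] <-]; apply: (@filterS _ _ _ [set x n]).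
    by move=> _ ->; exists n.
  by apply: open_nbhs_nbhs; split.
have cW k : closed (W k).
  rewrite -[W k]setCK; apply: open_closedC; rewrite openE => z nWz.
  have [U zU fU] := sparse z.
  pose F := x @` (M `&` [set n | (k <= n)%N] `&` x @^-1` U).
  have fF : finite_set F.
    apply: finite_image; apply: sub_finite_set fU => n [[Mn _] Un].
    by split.
  have zF : nbhs z (~` F).
    apply: open_nbhs_nbhs; split.
      apply: closed_openC; move/hausdorff_accessible: hX.
      by move/accessible_finite_set_closed; apply.
    by move=> [n [Mn _] xz]; apply: nWz; exists n.
  apply: filterS2 zU zF => y Uy nFy [n Mn xy]; apply: nFy.
  by exists n => //; split => //=; rewrite xy.
have [||k|z Wz] := nested_clopen_meet (C := W) pX.
- by move=> k; split.
- by move=> k _ [n [Mn kn] <-]; exists n => //; split => //; exact: ltnW.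
- have [n kn Mn] := (infinite_set_natP M).1 iM k.
  by exists (x n), n.
have [U zU fU] := sparse z.
apply: (_ : infinite_set (M `&` x @^-1` U)) fU.
apply/infinite_set_natP => k; have [n [Mn kn] xnz] := Wz k.
by exists n => //; split => //=; rewrite xnz; exact: nbhs_singleton.
Qed.

(** If an infinite set of indices does not converge to one of its cluster
    points [p], a small clopen neighbourhood of [p] cuts it into two infinite
    sets. *)
Lemma isolated_seq_subconverges {R : realType} {X : topologicalType}
    (x : nat -> X) :
  pseudocompact R X -> functionally_countable R X ->
  (forall n, open [set x n]) ->
  exists (M : set nat) (p : X), infinite_set M /\
    forall U, nbhs p U -> finite_set (M `\` x @^-1` U).
Proof.
move=> pX cX ox; apply: contrapT => no.
have [[_ crX] _] := pX.
pose P A := infinite_set (x @^-1` A).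
suff split_P A : P A -> exists C, [/\ clopen C, P (A `&` C) & P (A `&` ~` C)].
  have := no_splitting pX cX _ split_P (A := setT); apply.
    by move=> A /infinite_setN0[n An]; exists (x n).
  by rewrite /P preimage_setT; exact: infinite_nat.
move=> PA; pose M := x @^-1` A.
have [p pP] := isolated_seq_clusters pX ox PA.
have [U pU iU] : exists2 U, nbhs p U & infinite_set (M `\` x @^-1` U).
  apply: contrapT => nU; apply: no; exists M, p; split => // U pU.
  by apply: contrapT => iU; apply: nU; exists U.
have [C [cC Cp CU]] := clopen_base crX cX pU.
exists C; split => //.
- have : nbhs p C by apply: open_nbhs_nbhs; split => //; case: cC.
  by move=> /pP; rewrite /P preimage_setI.
- apply: sub_infinite_set iU => n [An nUn]; split => //.
  by move=> /CU.
Qed.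

(** * Pseudocompactness of the product *)

(** Cluster points of the two coordinates need not be reached along common
    indices; convergence of the first coordinates makes them so. *)
Lemma isolated_pairs_cluster {R : realType} {X Y : topologicalType}
    (z : nat -> X * Y) :
  pseudocompact R X -> functionally_countable R X -> pseudocompact R Y ->
  (forall n, open [set (z n).1] /\ open [set (z n).2]) ->
  exists p : X * Y, forall U, nbhs p U ->
    forall k, exists2 n, (k <= n)%N & U (z n).
Proof.
move=> pX cX pY oz.
have [M [p [iM cvp]]] := isolated_seq_subconverges (x := fun n => (z n).1)
  pX cX (fun n => (oz n).1).
have [q clq] := isolated_seq_clusters (x := fun n => (z n).2)
  pY (fun n => (oz n).2) iM.
exists (p, q) => W [[U V] /= [pU qV] UVW] k.
have iUV := infinite_setD (clq _ qV) (cvp _ pU).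
have [n kn [[Mn Vn] nUn]] := (infinite_set_natP _).1 iUV k.
exists n => //; apply: UVW; split => //=.
by apply: contrapT => nU; apply: nUn.
Qed.

Lemma isolated_pairs_dense {R : realType} {X Y : topologicalType}
    (W : set (X * Y)) :
  pseudocompact R X -> functionally_countable R X ->
  pseudocompact R Y -> functionally_countable R Y ->
  open W -> W !=set0 ->
  exists z, [/\ W z, open [set z.1] & open [set z.2]].
Proof.
move=> pX cX pY cY; rewrite openE => oW [[x y] /oW].
move=> [[U V] /= []]; rewrite !nbhsE.
move=> -[U' [oU' U'x] UU'] [V' [oV' V'y] VV'] UVW.
have [a U'a oa] := isolated_dense pX cX oU' (ex_intro _ x U'x).
have [b V'b ob] := isolated_dense pY cY oV' (ex_intro _ y V'y).
by exists (a, b); split => //; apply: UVW; split; [exact: UU'|exact: VV'].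
Qed.

Lemma hausdorff_prod {X Y : topologicalType} :
  hausdorff_space X -> hausdorff_space Y -> hausdorff_space (X * Y)%type.
Proof.
move=> hX hY [x y] [x' y'] cl; congr (_, _).
  apply: hX => A B xA x'B.
  have [||[a b] [/= Aa Ba]] := cl (A `*` setT) (B `*` setT).
  - by exists (A, setT) => //; split => //; exact: filterT.
  - by exists (B, setT) => //; split => //; exact: filterT.
  - by case: Aa; case: Ba => *; exists a.
apply: hY => A B yA y'B.
have [||[a b] [/= Aa Ba]] := cl (setT `*` A) (setT `*` B).
- by exists (setT, A) => //; split => //; exact: filterT.
- by exists (setT, B) => //; split => //; exact: filterT.
- by case: Aa; case: Ba => *; exists b.
Qed.

(** Products of clopen sets form a base of the product, and the indicator
    function of a clopen set is continuous. *)
Lemma functionally_countable_tychonoff_prod {R : realType}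
    {X Y : topologicalType} :
  tychonoff_space X -> functionally_countable R X ->
  tychonoff_space Y -> functionally_countable R Y ->
  tychonoff_space (X * Y)%type.
Proof.
move=> [hX crX] cX [hY crY] cY; split; first exact: hausdorff_prod.
apply: (@clopen_base_completely_regular R) => -[x y] W [[U V] /= [xU yV] UVW].
have [C [cC Cx CU]] := clopen_base crX cX xU.
have [D [cD Dy DV]] := clopen_base crY cY yV.
exists ((fst @^-1` C) `&` (snd @^-1` D)); split => //.
  apply: clopenI; apply: preimage_clopen => // z; first exact: cvg_fst.
  exact: cvg_snd.
by move=> [a b] [/CU Ua /DV Vb]; exact: UVW.
Qed.

Lemma open_norm_gt {R : realType} {T : topologicalType} (g : T -> R) (e : R) :
  continuous g -> open [set t | e < `|g t|].
Proof.
move=> cg; apply: (@open_comp _ _ (fun t => `|g t|) [set u | e < u]) => [t _|].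
  by apply: cvg_norm; exact: cg.
exact: open_gt.
Qed.

Lemma open_norm_lt {R : realType} {T : topologicalType} (g : T -> R) (e : R) :
  continuous g -> open [set t | `|g t| < e].
Proof.
move=> cg; apply: (@open_comp _ _ (fun t => `|g t|) [set u | u < e]) => [t _|].
  by apply: cvg_norm; exact: cg.
exact: open_lt.
Qed.

Lemma pseudocompact_prod {R : realType} {X Y : topologicalType} :
  pseudocompact R X -> functionally_countable R X ->
  pseudocompact R Y -> functionally_countable R Y ->
  pseudocompact R (X * Y)%type.
Proof.
move=> pX cX pY cY; split.
  have [[tX _] [tY _]] := (pX, pY).
  exact: (functionally_countable_tychonoff_prod tX cX tY cY).
move=> f cf; apply: contrapT => nb.
have large (n : nat) : exists z,
    [/\ n%:R < `|f z|, open [set z.1] & open [set z.2]].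
  apply: (isolated_pairs_dense (W := [set z | n%:R < `|f z|]) pX cX pY cY).
    exact: open_norm_gt.
  apply: contrapT => no; apply: nb; exists n%:R; split => // M nM z _ /=.
  by rewrite (le_trans _ (ltW nM))// leNgt; apply/negP => h; apply: no; exists z.
have [z zP] := choice large.
have [|p pP] := isolated_pairs_cluster (z := z) pX cX pY.
  by move=> n; have [] := zP n.
have nbp : nbhs p [set w | `|f w| < `|f p| + 1].
  by apply: open_nbhs_nbhs; split; [exact: open_norm_lt|rewrite /= ltrDl].
have [n kn /= fn] := pP _ nbp (Num.truncn (`|f p| + 1)).+1.
have [fn' _ _] := zP n.
have : `|f p| + 1 < n%:R.
  by apply: lt_le_trans (truncnS_gt _) _; rewrite ler_nat.
by rewrite ltNge (ltW (lt_trans fn' fn)).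
Qed.

(** * Functional countability of the product *)

(** Each [g i] is determined by the clopen sets [g i < r], where the threshold [r]
    lies outside the range of [g i] and one is chosen between any two rationals;
    these are countably many. *)
Lemma joint_range_countable {R : realType} {X : topologicalType}
    {I : countType} (g : I -> X -> R) :
  functionally_countable R X -> (forall i, continuous (g i)) ->
  countable (range (fun x i => g i x)).
Proof.
move=> cX cg.
have /choice[r rP] : forall j : I * rat * rat, exists r : R,
    ~ range (g j.1.1) r /\ ((j.1.2 < j.2)%R -> ratr j.1.2 < r /\ r < ratr j.2).
  move=> [[i q] q'] /=; have cr := cX _ (cg i).
  have [qq'|nqq'] := boolP (q < q').
    have [|r [qr rq' nr]] := countable_avoid cr (a := ratr q) (b := ratr q').
      by rewrite ltr_rat.
    by exists r.
  by have [r [_ _ nr]] := countable_avoid cr (@ltr01 R); exists r.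
pose C j := [set x | g j.1.1 x < r j].
have cC j : clopen (C j) by apply: gap_clopen => //; exact: (rP j).1.
apply: countable_range_factor (clopen_trace_countable cX cC) => x y xy.
have separated a b i :
    (fun j => `[< C j a >]) = (fun j => `[< C j b >]) -> ~~ (g i a < g i b).
  move=> ab; apply/negP => lt_ab.
  have [q] := rat_in_itvoo lt_ab; rewrite in_itv /= => /andP[aq qb].
  have [q'] := rat_in_itvoo qb; rewrite in_itv /= => /andP[qq' q'b].
  have [_ /=] := rP (i, q, q'); rewrite -(ltr_rat R) => /(_ qq')[qr rq'].
  have := congr1 (@^~ (i, q, q')) ab; rewrite /C /= asboolT ?(lt_trans aq)//.
  by rewrite asboolF//; apply/negP; rewrite -leNgt ltW// (lt_trans rq').
apply/funext => i; apply: le_anti; rewrite !leNgt.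
by rewrite !separated.
Qed.

(** Dependent choice where each term may be constrained by all the previous
    ones. *)
Lemma history_sequence {T : Type} (Q : seq T -> T -> Prop) :
  (forall s, exists z, Q s z) ->
  exists z : nat -> T, forall n, Q (mkseq z n) (z n).
Proof.
move=> /choice[g gQ].
pose hist := fix hist n :=
  if n is m.+1 then rcons (hist m) (g (hist m)) else [::].
exists (fun n => g (hist n)) => n.
suff -> : mkseq (fun n => g (hist n)) n = hist n by exact: gQ.
by elim: n => [//|n IH]; rewrite mkseqS IH.
Qed.

Lemma mem_mkseq_lt {T : eqType} (z : nat -> T) (i n : nat) :
  (i < n)%N -> z i \in mkseq z n.
Proof. by move=> ltin; apply: map_f; rewrite mem_iota. Qed.

Lemma slice_fst_continuous {X Y Z : topologicalType} (f : X * Y -> Z) (y : Y) :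
  continuous f -> continuous (fun x => f (x, y)).
Proof.
move=> cf x; apply: (@continuous_comp _ _ _ (fun x => (x, y)) f); last exact: cf.
by apply: cvg_pair; [exact: cvg_id|exact: cvg_cst].
Qed.

Lemma slice_snd_continuous {X Y Z : topologicalType} (f : X * Y -> Z) (x : X) :
  continuous f -> continuous (fun y => f (x, y)).
Proof.
move=> cf y; apply: (@continuous_comp _ _ _ (fun y => (x, y)) f); last exact: cf.
by apply: cvg_pair; [exact: cvg_cst|exact: cvg_id].
Qed.

Section Product.
Context {R : realType} {X Y : topologicalType}.
Hypotheses (pX : pseudocompact R X) (cX : functionally_countable R X).
Hypotheses (pY : pseudocompact R Y) (cY : functionally_countable R Y).
Variable f : X * Y -> R.
Hypothesis cf : continuous f.

Lemma shift_continuous (x0 : X) : continuous (fun z => f z - f (x0, z.2)).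
Proof.
move=> z; apply: cvgB; first exact: cf.
apply: (@continuous_comp _ _ _ snd (fun y => f (x0, y))); first exact: cvg_snd.
exact: slice_snd_continuous.
Qed.

Lemma slice_diff_continuous (x0 : X) (y : Y) :
  continuous (fun x => f (x, y) - f (x0, y)).
Proof.
by move=> x; apply: cvgB; [exact: slice_fst_continuous|exact: cvg_cst].
Qed.

(** Otherwise isolated pairs [z n] can be chosen where [f] is [e]-far from its
    value over [x0], with first coordinates so close to [x0] that over all the
    previous second coordinates [f] is [e / 2]-close to its value over [x0].
    At a cluster point [p] of these pairs, [f p] would be both [e / 2]-close to
    and at least [e] away from [f (x0, p.2)]. *)
Lemma slices_equicontinuous (x0 : X) (e : R) : 0 < e ->
  \forall x \near x0, forall y, `|f (x, y) - f (x0, y)| <= e.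
Proof.
move=> e0; apply: contrapT => no.
have bad U : nbhs x0 U -> exists z, [/\ U z.1, e < `|f z - f (x0, z.2)|,
    open [set z.1] & open [set z.2]].
  rewrite nbhsE => -[V [oV Vx0] VU].
  pose W := (fst @^-1` V) `&` [set z : X * Y | e < `|f z - f (x0, z.2)|].
  have oW : open W.
    apply: openI; last exact/open_norm_gt/shift_continuous.
    by apply: open_comp => // z _; exact: cvg_fst.
  have [|z [[Vz ez] oz1 oz2]] := isolated_pairs_dense pX cX pY cY oW.
    apply: contrapT => W0; apply: no.
    apply: filterS (open_nbhs_nbhs (conj oV Vx0)) => x Vx y.
    by rewrite leNgt; apply/negP => h; apply: W0; exists (x, y).
  by exists z; split => //; exact: VU.
have near_s (s : seq (X * Y)) : \forall x \near x0,
    forall w, w \in s -> `|f (x, w.2) - f (x0, w.2)| < e / 2.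
  elim: s => [|w s IH]; first by apply: filterS filterT => x _ w.
  have : \forall x \near x0, `|f (x, w.2) - f (x0, w.2)| < e / 2.
    apply: open_nbhs_nbhs; split; last by rewrite /= subrr normr0 divr_gt0.
    exact/open_norm_lt/slice_diff_continuous.
  apply: filterS2 IH => x IH wx v; rewrite inE => /predU1P[->//|]; exact: IH.
have [z zP] := history_sequence (fun s => bad _ (near_s s)).
have [|p pP] := isolated_pairs_cluster (z := z) pX cX pY.
  by move=> n; have [] := zP n.
(* The constraint that [z i] imposes on all later first coordinates passes to
   their cluster point [p.1]. *)
have limit i : `|f (p.1, (z i).2) - f (x0, (z i).2)| <= e / 2.
  rewrite leNgt; apply/negP => h.
  have nbp : nbhs p [set w | e / 2 < `|f (w.1, (z i).2) - f (x0, (z i).2)|].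
    apply: open_nbhs_nbhs; split => //.
    apply: (@open_comp _ _ fst
      [set x | e / 2 < `|f (x, (z i).2) - f (x0, (z i).2)|]) => [w _|].
      exact: cvg_fst.
    exact/open_norm_gt/slice_diff_continuous.
  have [n ltin /= en] := pP _ nbp i.+1; have [/= zn _ _ _] := zP n.
  by have := lt_trans en (zn _ (mem_mkseq_lt z ltin)); rewrite ltxx.
have nbp : nbhs p [set w | `|f w - f (p.1, w.2)| < e / 2].
  apply: open_nbhs_nbhs; split; first exact/open_norm_lt/shift_continuous.
  by rewrite /= -surjective_pairing subrr normr0 divr_gt0.
have [n _ /= close_n] := pP _ nbp 0%N; have [_ far_n _ _] := zP n.
have := ler_distD (f (p.1, (z n).2)) (f (z n)) (f (x0, (z n).2)).
have := limit n; lra.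
Qed.

(** Otherwise equicontinuity allows choosing isolated points whose slices are
    pairwise [e / 2]-apart; near a cluster point two of them are closer. *)
Lemma slices_totally_bounded (e : R) : 0 < e ->
  exists s : seq X, forall x, exists2 a, a \in s &
    forall y, `|f (x, y) - f (a, y)| <= e.
Proof.
move=> e0; apply: contrapT => no.
have far (s : seq X) : exists x, open [set x] /\
    forall a, a \in s -> exists y, e / 2 < `|f (x, y) - f (a, y)|.
  have [x xfar] : exists x, forall a, a \in s -> exists y,
      e < `|f (x, y) - f (a, y)|.
    apply: contrapT => nox; apply: no; exists s => x; apply: contrapT => noa.
    apply: nox; exists x => a sa; apply: contrapT => noy; apply: noa.
    exists a => // y; rewrite leNgt; apply/negP => h; apply: noy.
    by exists y.
  have e20 : 0 < e / 2 by rewrite divr_gt0.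
  have := slices_equicontinuous x e20.
  rewrite /prop_near1 nbhsE => -[V [oV Vx] Vclose].
  have [x' Vx' ox'] := isolated_dense pX cX oV (ex_intro _ x Vx).
  exists x'; split => // a /xfar[y xy]; exists y.
  have := Vclose _ Vx' y; have := ler_distD (f (x', y)) (f (x, y)) (f (a, y)).
  rewrite (distrC (f (x, y)) (f (x', y))); lra.
have [z zP] := history_sequence far.
have [p pP] := isolated_seq_clusters pX (fun n => (zP n).1) infinite_nat.
have e40 : 0 < e / 4 by rewrite divr_gt0.
have /infinite_set_natP near_p := pP _ (slices_equicontinuous p e40).
have [i _ [_ /= zi]] := near_p 0%N; have [n ltin [_ /= zn]] := near_p i.+1.
have [y] := (zP n).2 _ (mem_mkseq_lt z ltin).
have := zi y; have := zn y.
have := ler_distD (f (p, y)) (f (z n, y)) (f (z i, y)).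
rewrite (distrC (f (p, y))); lra.
Qed.

Lemma countable_range_prod : countable (range f).
Proof.
have /choice[s sP] : forall k : nat, exists s : seq X, forall x,
    exists2 a, a \in s & forall y, `|f (x, y) - f (a, y)| <= k.+1%:R^-1.
  by move=> k; apply: slices_totally_bounded; rewrite invr_gt0.
pose g (j : nat * nat) y := if onth (s j.1) j.2 is Some a then f (a, y) else 0.
have cg j : continuous (g j).
  rewrite /g; case: onth => [a|]; first exact: slice_snd_continuous.
  by move=> y; exact: cvg_cst.
(* The points of the [s k] are dense among the [x] for the uniform distance of
   slices, so [y] enters only through the values of [f (_, y)] at them. *)
have cslices : countable (range (fun y x => f (x, y))).
  apply: countable_range_factor (joint_range_countable cY cg) => y y' yy'.
  apply/funext => x; apply/eqP; rewrite -subr_eq0 -normr_le0.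
  apply/ler_addgt0Pl => e e0; rewrite addr0.
  have e20 : 0 < e / 2 by rewrite divr_gt0.
  have [k _ /(_ k (leqnn _)) kP] := near_infty_natSinv_lt (PosNum e20).
  have [a ask xa] := sP k x.
  have ayy' : f (a, y) = f (a, y').
    have /onthP[j ja] := ask.
    by have := congr1 (@^~ (k, j)) yy'; rewrite /g /= ja.
  have := xa y; have := xa y'; rewrite (distrC (f (x, y'))) ayy'.
  have := ler_distD (f (a, y')) (f (x, y)) (f (x, y')).
  move: kP => /=; move: (k.+1%:R^-1) => d; lra.
suff -> : range f = \bigcup_(h in range (fun y x => f (x, y))) range h.
  apply: bigcup_countable => // _ [y _ <-].
  by apply: cX; exact: slice_fst_continuous.
apply/seteqP; split => [_ [[x y] _ <-]|_ [_ [y _ <-] [x _ <-]]].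
  by exists (fun x => f (x, y)); [exists y|exists x].
by exists (x, y).
Qed.

End Product.

Theorem theorem9 (R : realType) (X Y : topologicalType)
    (pX : pseudocompact R X) (cX : functionally_countable R X)
    (pY : pseudocompact R Y) (cY : functionally_countable R Y) :
  pseudocompact R (X * Y)%type /\ functionally_countable R (X * Y)%type.
Proof.
split; first exact: pseudocompact_prod.
by move=> f cf; exact: countable_range_prod.
Qed.
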